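(* Let $n\ge2$, $m\in\{1,\dots,n-1\}$, and let $p_1,\dots,p_n,q_1,\dots,q_n\ge0$ be integers. Then for every integer $t\ge0$, $$\Delta_t^{-1}\,d_{N_1t}\cdots d_{N_mt}\;\mathbf T^m\big(\mathcal L_n(p_1t,q_1t;\dots;p_nt,q_nt;z)\big)\in\mathbb Z[z].$$
   Context: For $k\ge0$, $D_kf(u)=\frac1{k!}\frac{d^k}{du^k}f(u)$. Multiple Legendre polynomials: $\mathcal L_0(z)=1$, $\mathcal L_n(p_1,q_1;\dots;p_n,q_n;z)=z^{q_n}(1-z)^{p_n}D_{p_n+q_n}\big(z^{p_n}(1-z)^{q_n}\mathcal L_{n-1}(p_1,q_1;\dots;p_{n-1},q_{n-1};z)\big)$. $\mathbf T(P)(z)=\int_0^1\frac{P(z)-P(y)}{z-y}dy$ on $\mathbb C[z]$, $\mathbf T^m$ its $m$-fold iterate. For real $x$, $d_x$ is the least common multiple of $1,2,\dots,\lfloor x\rfloor$ (and $d_x=1$ if $x<1$). Let $K_1\ge\cdots\ge K_{n^2}$ be the numbers $p_i+q_j$ ($i,j=1,\dots,n$) in nonincreasing order, $N_1=K_1$, $N_j=\max\{K_j,K_1/j\}$ ($j=2,\dots,n$). For $\omega\in[0,1)$, $\mu(\omega)=\max_{\sigma\in\mathfrak S_n}\sum_{j=1}^n\big([(p_j+q_{\sigma(j)})\omega]-[(p_j+q_j)\omega]\big)\ge0$, $[x]$ the integer part. For an integer $t\ge0$, $\Delta_t=\prod_{s}s^{\mu(\{t/s\})}$, the product over primes $s>\sqrt{N_1t}$,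 where $\{x\}=x-[x]$ (only finitely many factors differ from $1$). *)

(* Defs.v *)
From HB Require Import structures.
From mathcomp Require Import all_boot all_order all_algebra all_fingroup.
From mathcomp Require Import all_classical all_reals all_analysis.
From mathcomp.real_closed Require Import complex.
Set Implicit Arguments.
Unset Strict Implicit.
Unset Printing Implicit Defensive.
Import Order.TTheory GRing.Theory Num.Theory.
Local Open Scope classical_set_scope.
Local Open Scope ring_scope.
Local Open Scope complex_scope.

Definition Dk (F : fieldType) (k : nat) (P : {poly F}) : {poly F} :=
  (k`!%:R)^-1 *: P^`(k).

Definition legendre_step (F : fieldType) (L : {poly F}) (pq : nat * nat) :
    {poly F} :=
  let: (a, b) := pq in
  'X ^+ b * (1 - 'X) ^+ a * Dk (a + b) ('X ^+ a * (1 - 'X) ^+ b * L).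

(* The i-th pair of the list is (p_i, q_i); the left fold makes the last pair
   the outermost application of the recursion. *)
Definition legendre (F : fieldType) (s : seq (nat * nat)) : {poly F} :=
  foldl (@legendre_step F) 1 s.

(* Integral over [0,1] of a complex-valued function of a real variable. *)
Definition cintegral01 (R : realType) (g : R -> R[i]) : R[i] :=
  (\int[@lebesgue_measure R]_(y in `[0, 1]) complex.Re (g y))
  +i* (\int[@lebesgue_measure R]_(y in `[0, 1]) complex.Im (g y)).

(* Polynomials over R[i] are identified with the functions they define.
   For z in [0,1] the integrand is 0 at y = z (division by zero), which does
   not affect the Lebesgue integral. *)
Definition Top (R : realType) (f : R[i] -> R[i]) : R[i] -> R[i] :=
  fun z => cintegral01 (fun y : R => (f z - f y%:C) / (z - y%:C)).

(* Num.truncn x is the integer part of x if 0 <= x, and 0 if x < 0. *)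
Definition dlcm (R : realType) (x : R) : nat :=
  \big[lcmn/1%N]_(1 <= k < (Num.truncn x).+1) k.

Section Denominators.
Variables (R : realType) (n : nat) (p q : 'I_n -> nat).

(* The decreasing list of the n^2 numbers p_i + q_j, with 1-based access. *)
Definition Kseq : seq nat :=
  sort geq [seq (p i + q j)%N | i <- enum 'I_n, j <- enum 'I_n].

Definition K (j : nat) : nat := nth 0%N Kseq j.-1.

Definition N (j : nat) : R :=
  if (j == 1)%N then (K 1)%:R
  else Num.max (K j)%:R ((K 1)%:R / j%:R).

(* Starting the maximum at 0 is harmless: the identity permutation gives 0. *)
Definition mu (w : R) : int :=
  \big[Num.max/0]_(s : 'S_n) \sum_(j < n)
    (Num.floor ((p j + q (s j))%:R * w) - Num.floor ((p j + q j)%:R * w)).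

Definition frac (x : R) : R := x - (Num.floor x)%:~R.

Definition Delta_primes (t : nat) : set nat :=
  [set s : nat | prime s /\ Num.sqrt (N 1 * t%:R) < s%:R].

(* The exponent is nonnegative, see mu_ge0; the big operator over a set takes
   the product of the factors different from 1, which are finitely many, see
   Delta_finite. *)
Definition Delta (t : nat) : nat :=
  (\big[muln/1]_(s \in Delta_primes t) s ^ `|mu (frac (t%:R / s%:R))|)%N.

Lemma mu_ge0 (w : R) : 0 <= mu w.
Proof. exact: bigmax_ge_id. Qed.

Lemma mu_small (w : R) : 0 <= w ->
  (forall i j, (p i + q j)%:R * w < 1) -> mu w = 0.
Proof.
move=> w0 small; rewrite /mu big1_idem//= ?maxxx// => s _.
have fl0 i j : Num.floor ((p i + q j)%:R * w) = 0.
  by apply/eqP; rewrite floor_eq/= mulr_ge0//= add0r small.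
by rewrite big1// => j _; rewrite !fl0 subrr.
Qed.

Lemma Delta_finite (t : nat) :
  finite_set [set s | Delta_primes t s /\
    (s ^ `|mu (frac (t%:R / s%:R))|)%N <> 1%N].
Proof.
pose B := ((\sum_(i < n) \sum_(j < n) (p i + q j)).+1 * t.+1)%N.
apply: (@sub_finite_set _ _ `I_B); last exact: finite_II.
move=> s /= [_ hs]; rewrite ltnNge; apply/negP => Bs; apply: hs.
have s0 : (0 < s)%N by apply: leq_trans Bs; rewrite muln_gt0.
have s0R : 0 < s%:R :> R by rewrite ltr0n.
have ts : (t < s)%N by apply: leq_trans Bs; rewrite leq_pmull.
have fr : frac (t%:R / s%:R) = t%:R / s%:R.
  rewrite /frac (_ : Num.floor _ = 0) ?subr0//; apply/eqP.
  by rewrite floor_eq/= divr_ge0//= add0r ltr_pdivrMr// mul1r ltr_nat.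
rewrite fr mu_small ?expn0 ?divr_ge0// => i j.
rewrite mulrA ltr_pdivrMr// mul1r -natrM ltr_nat.
apply: leq_trans Bs; rewrite /B ltn_mul// ltnS.
by rewrite (bigD1 i)//= (bigD1 j)//= -addnA leq_addr.
Qed.

End Denominators.

(* Main.v *)
Require Import Defs.
From HB Require Import structures.
From mathcomp Require Import all_boot all_order all_algebra all_fingroup.
From mathcomp Require Import all_classical all_reals all_analysis.
From mathcomp.real_closed Require Import complex.
From mathcomp Require Import measurable_realfun ring zify.
Import Order.TTheory GRing.Theory Num.Theory.
Local Open Scope ring_scope.

(** The linear map [umbral], sending the polynomial binom(s, k) in s to (-z)^k,
intertwines multiplication by s with [theta u = z ((1 - z) u)'].  Each step of
the Legendre recursion is a polynomial in [theta], so L_n is the image of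
f(s) = prod_j binom(s + p_j, p_j + q_j).  Since [T, theta] = -1, the operator
T acts as -d/ds, so T^m L_n is the image of (-1)^m f^(m).  The image of a
polynomial taking integer values on the naturals has integer coefficients, so
it remains to bound p-adically the values of f^(m) at naturals.  These are
sums of products obtained from f by deleting m of its linear factors.  The
factors of f can be regrouped into blocks of length p_j + q_(g j) for any
permutation g; choosing g to attain the maximum [mu] accounts for Delta, and
counting the multiples of each prime power in the blocks shows that the
deletion costs at most the m lcm's. *)

(** * The umbral map *)

Section DerivnLinearFactor.
Context {A : comNzRingType}.
Implicit Types u : {poly A}.

Lemma derivn_mulXDC (c : A) k u :
  (('X + c%:P) * u)^`(k.+1) = ('X + c%:P) * u^`(k.+1) + u^`(k) *+ k.+1.
Proof.
elim: k => [|k IH]; first by rewrite !derivn1 derivn0 !poly.derivE mulr1n; ring.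
by rewrite derivnS IH !poly.derivE -!derivnS; ring.
Qed.

Lemma derivn_mulX k u : ('X * u)^`(k.+1) = 'X * u^`(k.+1) + u^`(k) *+ k.+1.
Proof. by have := derivn_mulXDC 0 k u; rewrite !addr0. Qed.

Lemma derivn_mul1BX k u :
  ((1 - 'X) * u)^`(k.+1) = (1 - 'X) * u^`(k.+1) - u^`(k) *+ k.+1.
Proof. by rewrite mulrBl mul1r derivnB derivn_mulX; ring. Qed.

(** By Leibniz, the derivative is a sum, with repetitions, of the products left after deleting [m]
    of the factors. An additive predicate therefore only needs checking on those products, which are
    recorded by masks. *)
Lemma derivn_prod_ind (S : {poly A} -> Prop) m (l : seq A) :
  S 0 -> (forall u v, S u -> S v -> S (u + v)) ->
  (forall msk : bitseq, size msk = size l -> count negb msk = m ->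
     S (\prod_(x <- mask msk l) ('X + x%:P))) ->
  S (\prod_(x <- l) ('X + x%:P))^`(m).
Proof.
elim: l m S => [|x l IH] [|m] S S0 SD Smask.
- by rewrite derivn0; apply: (Smask [::]).
- by rewrite big_nil -[1]/(1%:P) derivnC.
- rewrite derivn0; have := Smask (nseq (size l).+1 true).
  by rewrite mask_true// size_nseq count_nseq; apply.
- have SMn u k : S u -> S (u *+ k).
    by move=> Su; elim: k => // k IHk; rewrite mulrS; exact: SD.
  rewrite big_cons derivn_mulXDC; apply: (SD _ _).
  (* The head factor is kept here and absorbed into the predicate, which is why the induction
     generalizes [S]. *)
  * apply: (IH m.+1 (fun u => S (('X + x%:P) * u))).
    + by rewrite mulr0.
    + by move=> u v Su Sv; rewrite mulrDr; exact: SD.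
    + move=> msk sm cm; have := Smask (true :: msk).
      by rewrite /= sm cm big_cons; apply.
  * apply: SMn; apply: IH => // msk sm cm.
    by have := Smask (false :: msk); rewrite /= sm cm; apply.
Qed.

End DerivnLinearFactor.

Section Umbral.
Context {F : fieldType}.
Implicit Types f g u : {poly F}.

(** The linear extension of ['X^i] ↦ [h i]. With a general target module it serves for the umbral
    map, for T and for integration over [0, 1]. *)
Definition monomial_ext {V : lmodType F} (h : nat -> V) f : V :=
  \sum_(i < size f) f`_i *: h i.

Lemma monomial_ext_wide {V : lmodType F} (h : nat -> V) n f : (size f <= n)%N ->
  monomial_ext h f = \sum_(i < n) f`_i *: h i.
Proof.
move=> fn; rewrite /monomial_ext (big_ord_widen n (fun i => f`_i *: h i))//.
rewrite big_mkcond/=; apply: eq_bigr => i _; case: ltnP => // fi.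
by rewrite nth_default// scale0r.
Qed.

Lemma monomial_ext_is_linear {V : lmodType F} (h : nat -> V) :
  linear (monomial_ext h).
Proof.
move=> a f g; pose n := maxn (size f) (size g).
rewrite !(@monomial_ext_wide _ _ n) ?leq_maxl ?leq_maxr//.
  rewrite scaler_sumr -big_split/=; apply: eq_bigr => i _.
  by rewrite coefD coefZ scalerDl scalerA.
rewrite (leq_trans (size_polyD _ _))// geq_max leq_maxr andbT.
by rewrite (leq_trans (size_scale_leq _ _))// leq_maxl.
Qed.

HB.instance Definition _ (V : lmodType F) (h : nat -> V) :=
  GRing.isLinear.Build F {poly F} V _ (monomial_ext h) (monomial_ext_is_linear h).

Lemma monomial_extXn {V : lmodType F} (h : nat -> V) n :
  monomial_ext h 'X^n = h n.
Proof.
rewrite /monomial_ext size_polyXn big_ord_recr/= coefXn eqxx scale1r.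
by rewrite big1 ?add0r// => i _; rewrite coefXn ltn_eqF ?scale0r.
Qed.

Definition theta u : {poly F} := 'X * ((1 - 'X) * u)^`().

Lemma thetaE u : theta u = 'X * (1 - 'X) * u^`() - 'X * u.
Proof. by rewrite /theta !poly.derivE; ring. Qed.

Lemma thetaXn k : theta 'X^k = k%:R *: 'X^k - k.+1%:R *: 'X^(k.+1).
Proof.
rewrite thetaE derivXn -!mul_polyC !rmorph_nat.
by case: k => [|k]; rewrite /= ?exprS; ring.
Qed.

Lemma theta_is_linear : linear theta.
Proof. by move=> a u v; rewrite !thetaE !poly.derivE -!mul_polyC; ring. Qed.

HB.instance Definition _ :=
  GRing.isLinear.Build F {poly F} {poly F} _ theta theta_is_linear.

(** This is f ↦ f(theta) 1, so the intertwining property is built in; the values at the binomials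
    then follow from [umbral_forward]. *)
Definition umbral : {poly F} -> {poly F} :=
  monomial_ext (fun i => iter i theta 1).

HB.instance Definition _ := GRing.Linear.on umbral.

Lemma umbral1 : umbral 1 = 1.
Proof. by rewrite -(expr0 'X) /umbral monomial_extXn. Qed.

Lemma umbralC c : umbral c%:P = c%:P.
Proof. by rewrite -alg_polyC linearZ/= umbral1. Qed.

Lemma umbralMX f : umbral ('X * f) = theta (umbral f).
Proof.
rewrite -[f]coefK poly_def mulr_sumr !(linear_sum umbral)/= (linear_sum theta)/=.
apply: eq_bigr => i _; rewrite -scalerAr !linearZ/=.
by rewrite -exprS /umbral !monomial_extXn.
Qed.

Lemma umbralMXD f c : umbral (('X + c%:P) * f) = theta (umbral f) + c *: umbral f.
Proof. by rewrite mulrDl linearD/= umbralMX mul_polyC linearZ. Qed.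

(** The polynomial binom(s + a, a + b), split into its factors s + 1, ..., s + a and s, ..., s - b +
    1. *)
Definition ubinom (a b : nat) : {poly F} :=
  ((a + b)`!%:R)^-1 *:
    (\prod_(i < a) ('X + (i.+1%:R)%:P) * \prod_(i < b) ('X + (- (i%:R))%:P)).

(** A Legendre step without its factor 1 / (a + b)!, so that the recursions in [a] and [b] are free
    of denominators. *)
Definition ustep (a b : nat) f : {poly F} :=
  'X ^+ b * (1 - 'X) ^+ a * ('X ^+ a * (1 - 'X) ^+ b * f)^`(a + b).

(** With g the inner derivative, Leibniz for the extra factor z gives z g' + (a + b + 1) g; applying
    [theta] and adding a + 1 times the old step produces the same two terms. *)
Lemma ustepSl a b f :
  ustep a.+1 b f = theta (ustep a b f) + a.+1%:R *: ustep a b f.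
Proof.
rewrite /ustep addSn (exprS 'X) -!mulrA derivn_mulX derivnS thetaE.
move: (_^`(a + b)) => g; rewrite -mul_polyC rmorph_nat.
(* The case split removes the truncated predecessors in the exponents of differentiated powers. *)
by case: b => [|b]; case: a => [|a]; rewrite !(poly.derivE, deriv_exp)/= ?exprS; ring.
Qed.

Lemma ustepSr a b f :
  ustep a b.+1 f = theta (ustep a b f) + - b%:R *: ustep a b f.
Proof.
rewrite /ustep addnS (exprS (1 - 'X) b) -!mulrA [_ ^+ a * ((1 - _) * _)]mulrCA.
rewrite derivn_mul1BX derivnS thetaE.
move: (_^`(a + b)) => g; rewrite -mul_polyC rmorphN rmorph_nat.
by case: b => [|b]; case: a => [|a]; rewrite !(poly.derivE, deriv_exp)/= ?exprS; ring.
Qed.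

Lemma umbral_ustep a b f :
  ustep a b (umbral f) =
  umbral ((\prod_(i < a) ('X + (i.+1%:R)%:P) *
           \prod_(i < b) ('X + (- (i%:R))%:P)) * f).
Proof.
elim: a => [|a IHa]; last first.
  by rewrite ustepSl IHa -umbralMXD big_ord_recr/=; congr umbral; ring.
elim: b => [|b IHb]; last first.
  by rewrite ustepSr IHb -umbralMXD [in RHS]big_ord_recr/=; congr umbral; ring.
by rewrite /ustep !big_ord0 !expr0 !mul1r.
Qed.

Lemma legendre_umbral (s : seq (nat * nat)) :
  legendre F s = umbral (\prod_(x <- s) ubinom x.1 x.2).
Proof.
elim/last_ind: s => [|s [a b] IH].
  by rewrite big_nil umbral1.
rewrite /legendre foldl_rcons -/(legendre F s) IH big_rcons/=.
rewrite /Dk -scalerAr -/(ustep a b (umbral _)) umbral_ustep -linearZ/=.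
by rewrite scalerAl [X in _ = umbral X]mulrC.
Qed.

(** * Forward differences and integrality of umbral images *)

Definition forward f : {poly F} := f \Po ('X + 1) - f.

Lemma forward_is_linear : linear forward.
Proof. by move=> a f g; rewrite /forward comp_polyD comp_polyZ -!mul_polyC; ring. Qed.

HB.instance Definition _ :=
  GRing.isLinear.Build F {poly F} {poly F} _ forward forward_is_linear.

Lemma forwardC c : forward c%:P = 0.
Proof. by rewrite /forward comp_polyC subrr. Qed.

Lemma forwardMX f : forward ('X * f) = ('X + 1) * forward f + f.
Proof. by rewrite /forward comp_polyM comp_polyX; ring. Qed.

(** One step of Newton's interpolation at 0: iterating it gives the sum of the k-th differences at 0
    times (-z)^k. *)
Lemma umbral_forward f : umbral f = f.[0]%:P - 'X * umbral (forward f).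
Proof.
elim/poly_ind: f => [|f c IH]; first by rewrite !linear0 mulr0 horner0 subr0.
have -> : forward (f * 'X + c%:P) = ('X + 1%:P) * forward f + f.
  by rewrite linearD/= forwardC addr0 mulrC forwardMX.
rewrite !(mulrC f) 2!linearD/= umbralC umbralMX umbralMXD scale1r.
rewrite !hornerE IH; set u := umbral (forward f).
by rewrite !thetaE !poly.derivE; ring.
Qed.

Lemma size_forward f : (size (forward f) <= (size f).-1)%N.
Proof.
have s2 : size ('X + 1 : {poly F}) = 2%N by rewrite -[1]/(1%:P) size_XaddC.
have sf : size (f \Po ('X + 1)) = size f by rewrite size_comp_poly2.
have lf : lead_coef (f \Po ('X + 1)) = lead_coef f.
  by rewrite lead_coef_comp ?s2// -[1]/(1%:P) lead_coefXaddC expr1n mulr1.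
apply/leq_sizeP => j; rewrite leq_eqVlt coefB => /predU1P[<-|fj].
  by rewrite -[in X in X - _]sf -!lead_coefE lf subrr.
have {}fj : (size f <= j)%N by case: (size f) fj.
by rewrite !nth_default ?sf// subrr.
Qed.

(** Induction on the size: the forward difference is again integer valued on the naturals and has
    smaller degree. *)
Lemma umbral_int f : (forall s : nat, exists c : int, f.[s%:R] = c%:~R) ->
  exists Q : {poly int}, umbral f = map_poly intr Q.
Proof.
have [n] := ubnP (size f); elim: n f => // n IH f fn fZ.
have [->|f0] := eqVneq f 0; first by exists 0; rewrite linear0 rmorph0.
have [c fc] := fZ 0%N.
have [||Q fQ] := IH (forward f).
- rewrite (leq_ltn_trans (size_forward f))//.
  by move: fn; rewrite ltnS; apply: leq_trans; rewrite prednK// size_poly_gt0.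
- move=> s; have [a fa] := fZ s; have [b fb] := fZ s.+1; exists (b - a).
  by rewrite /forward !hornerE horner_comp !hornerE fa natr1 fb intrB.
exists (c%:P - 'X * Q); rewrite umbral_forward fQ -[0]/(0%:R) fc.
by rewrite rmorphB rmorphM/= map_polyC map_polyX.
Qed.

(** The coefficient 1 / (k - j) is the integral of y^(k - 1 - j), from the expansion of (z^k - y^k)
    / (z - y). *)
Definition Tpoly : {poly F} -> {poly F} :=
  monomial_ext (fun k => \sum_(j < k) (k - j)%:R^-1 *: 'X^j).

HB.instance Definition _ := GRing.Linear.on Tpoly.

Lemma TpolyXn k : Tpoly 'X^k = \sum_(j < k) (k - j)%:R^-1 *: 'X^j.
Proof. by rewrite /Tpoly monomial_extXn. Qed.

Context (F0 : [pchar F] =i pred0).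

Lemma Tpoly_theta u : Tpoly (theta u) = theta (Tpoly u) - u.
Proof.
have nat0 n : (n%:R == 0 :> F) = (n == 0%N) by move: n; exact/pcharf0P.
rewrite -[u]coefK poly_def (linear_sum theta)/= !(linear_sum Tpoly)/=.
rewrite (linear_sum theta)/= -sumrB; apply: eq_bigr => -[k _] _ /=.
rewrite !linearZ/= -scalerDr; congr (_ *: _).
rewrite thetaXn linearB !linearZ/= !TpolyXn (linear_sum theta)/=.
under [X in _ = X - _]eq_bigr do rewrite linearZ/= thetaXn scalerBr.
rewrite sumrB.
(* The common summand after shifting the index by one; its term at j = 0 vanishes. Below, k = (k -
   i) + i splits off a plain sum of powers. The two plain sums differ by ['X^k], which is the
   commutator term. *)
pose h (j : nat) : {poly F} := (k.+1 - j)%:R^-1 *: (j%:R *: 'X^j).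
have -> : \sum_(i < k) (k - i)%:R^-1 *: (i.+1%:R *: 'X^(i.+1)) =
          \sum_(j < k.+1) h j :> {poly F}.
  by rewrite big_ord_recl/= /h scale0r scaler0 add0r.
have -> : k%:R *: (\sum_(j < k) (k - j)%:R^-1 *: 'X^j : {poly F}) =
  \sum_(i < k) (k - i)%:R^-1 *: (i%:R *: 'X^i) + \sum_(i < k) 'X^i :> {poly F}.
  rewrite scaler_sumr -big_split/=; apply: eq_bigr => -[i ik] _ /=.
  rewrite ?/h !scalerA -[X in _ = _ + X]scale1r -scalerDl; congr (_ *: _).
  have ne : (k - i)%:R != 0 :> F by rewrite nat0 subn_eq0 -ltnNge.
  by rewrite -[X in X%:R * _](subnK (ltnW ik)) natrD; field.
rewrite scalerN.
have -> : k.+1%:R *: (\sum_(j < k.+1) (k.+1 - j)%:R^-1 *: 'X^j : {poly F}) =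
  \sum_(i < k.+1) h i + \sum_(i < k.+1) 'X^i :> {poly F}.
  rewrite scaler_sumr -big_split/=; apply: eq_bigr => -[i ik] _ /=.
  rewrite ?/h !scalerA -[X in _ = _ + X]scale1r -scalerDl; congr (_ *: _).
  have ne : (k.+1 - i)%:R != 0 :> F by rewrite nat0 subn_eq0 -ltnNge.
  by rewrite -[X in X%:R * _](subnK (ltnW ik)) natrD; field.
by rewrite [X in _ - (_ + X)]big_ord_recr/=; ring.
Qed.

(** Both T and -d/ds kill constants, and [T, theta] = -1 corresponds to [-d/ds, s] = -1, so
    induction on the degree identifies them. *)
Lemma Tpoly_umbral f : Tpoly (umbral f) = - umbral f^`().
Proof.
elim/poly_ind: f => [|f c IH]; first by rewrite deriv0 !linear0.
rewrite (mulrC f) linearD/= umbralC umbralMX linearD/= Tpoly_theta IH.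
have -> : Tpoly c%:P = 0.
  by rewrite -alg_polyC linearZ/= -(expr0 'X) TpolyXn big_ord0 scaler0.
have -> : ('X * f + c%:P)^`() = f + 'X * f^`().
  by rewrite !poly.derivE mul1r addr0.
by rewrite (linearD umbral)/= umbralMX (linearN theta)/=; ring.
Qed.

Lemma iter_Tpoly_umbral m f : iter m Tpoly (umbral f) = (-1) ^+ m *: umbral f^`(m).
Proof.
elim: m => [|m IH]; first by rewrite scale1r.
by rewrite iterS IH derivnS exprS linearZ/= Tpoly_umbral scalerN mulN1r scaleNr.
Qed.

End Umbral.

(** * The operator T on polynomials *)

Section TopPolynomial.
Import numFieldNormedType.Exports.
Context {R : realType}.
Local Notation C := R[i].
Local Notation mu := (@lebesgue_measure R).

Lemma Rintegral01_deriv (f : {poly R}) :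
  \int[mu]_(y in `[0, 1]%classic) (f^`()).[y] = f.[1] - f.[0].
Proof.
rewrite /Rintegral (@continuous_FTC2 _ _ (horner f))//=.
- by apply: continuous_subspaceT; exact: continuous_horner.
- split.
  + by move=> x _; exact: derivable_horner.
  + by apply: cvg_at_right_filter; exact: continuous_horner.
  + by apply: cvg_at_left_filter; exact: continuous_horner.
- by move=> x _; rewrite -derive.derivE.
Qed.

(** At i = 0 the division by zero makes the constant term 0. *)
Definition antideriv (f : {poly R}) : {poly R} :=
  \poly_(i < (size f).+1) (f`_i.-1 / i%:R).

Lemma antiderivK f : (antideriv f)^`() = f.
Proof.
apply/polyP => i; rewrite coef_deriv coef_poly ltnS /=.
case: ltnP => [_|fi]; last by rewrite mul0rn nth_default.
by rewrite -[LHS]mulr_natr divfK// pnatr_eq0.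
Qed.

Lemma Rintegral01_horner (f : {poly R}) :
  \int[mu]_(y in `[0, 1]%classic) f.[y] = \sum_(i < size f) f`_i / i.+1%:R.
Proof.
rewrite -[in LHS](antiderivK f) Rintegral01_deriv /antideriv horner_poly.
rewrite horner_coef0 coef_poly/= invr0 mulr0 subr0 big_ord_recl/= invr0 mulr0.
rewrite mul0r add0r; apply: eq_bigr => i _.
by rewrite expr1n mulr1.
Qed.

(** The two integrands can differ only at the real part of [z], and a single point has Lebesgue
    measure 0. *)
Lemma Rintegral01_ae_horner (z : C) (g : R -> R) (f : {poly R}) :
  (forall y, z != y%:C%C -> g y = f.[y]) ->
  \int[mu]_(y in `[0, 1]%classic) g y = \int[mu]_(y in `[0, 1]%classic) f.[y].
Proof.
move=> gf; rewrite /Rintegral.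
pose h : R -> R := horner f.
have mf : measurable_fun [set: R] (EFin \o h : R -> \bar R).
  apply/measurable_EFinP; apply: continuous_measurable_fun.
  exact: continuous_horner.
pose a := complex.Re z.
have gf' y : y != a -> g y = f.[y].
  by move=> ya; apply: gf; apply: contra_neq ya => za; rewrite /a za.
congr fine; rewrite -(@integral_setD1 _ (fun y => (g y)%:E) a).
- rewrite -[RHS](@integral_setD1 _ _ a).
  + by apply: eq_integral => y; rewrite inE => -[_ /eqP ya]; rewrite gf'.
  + exact: measurableD.
  + exact: measurable_funTS.
- exact: measurableD.
- apply: (@eq_measurable_fun _ _ _ _ _ (EFin \o h)).
    by move=> y; rewrite inE => -[_ /eqP ya]; rewrite gf'.
  exact: measurable_funTS.
Qed.

(** The real and imaginary parts are treated together: [phi] stands for either. *)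
Lemma Rintegral01_part (phi : C -> R) (Q : {poly C}) (z : C) (g : R -> C) :
  {morph phi : x y / x + y} -> (forall c x, phi (c * x%:C%C) = phi c * x) ->
  (forall y, z != y%:C%C -> g y = Q.[y%:C%C]) ->
  \int[mu]_(y in `[0, 1]%classic) phi (g y) =
  phi (\sum_(i < size Q) Q`_i / i.+1%:R).
Proof.
move=> phiD phiM gQ.
have phi0 : phi 0 = 0 by rewrite -[in LHS](mul0r 0%:C%C) phiM mulr0.
have phi_sum n (h : 'I_n -> C) : phi (\sum_i h i) = \sum_i phi (h i).
  by apply: (big_morph phi).
pose f := \poly_(i < size Q) phi Q`_i.
rewrite (@Rintegral01_ae_horner z _ f); last first.
  move=> y zy; rewrite gQ// horner_coef phi_sum /f horner_poly.
  by apply: eq_bigr => i _; rewrite -rmorphXn/= phiM.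
rewrite Rintegral01_horner phi_sum.
(* [f] may be shorter than [Q], as [phi] can kill leading coefficients; the added terms are 0. *)
rewrite (big_ord_widen (size Q) (fun i => f`_i / i.+1%:R)) ?size_poly//.
rewrite big_mkcond/=; apply: eq_bigr => i _; case: ltnP => fi.
  rewrite coef_poly ltn_ord -phiM; congr phi; congr (_ * _).
  by rewrite fmorphV rmorph_nat.
have : f`_i = 0 by rewrite nth_default.
rewrite coef_poly ltn_ord => Qi0.
by rewrite -[i.+1%:R](rmorph_nat (real_complex R)) -fmorphV phiM Qi0 mul0r.
Qed.

Lemma cintegral01_horner (Q : {poly C}) (z : C) (g : R -> C) :
  (forall y, z != y%:C%C -> g y = Q.[y%:C%C]) ->
  cintegral01 g = \sum_(i < size Q) Q`_i / i.+1%:R.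
Proof.
move=> gQ; rewrite /cintegral01 !(@Rintegral01_part _ Q z)//.
- by case: (\sum_(i < _) _).
- by move=> [a b] [c d].
- by move=> [a b] x /=; rewrite mulr0 add0r mulrC.
- by move=> [a b] [c d].
- by move=> [a b] x /=; rewrite mulr0 subr0.
Qed.

Lemma Top_horner (P : {poly C}) :
  Top (fun x => P.[x]) = (fun x => (Tpoly P).[x]).
Proof.
apply/funext => z; rewrite /Top.
(* For fixed z, the difference quotient of [P] as a polynomial in y. *)
pose Q := \sum_(k < size P) P`_k *: \sum_(j < k) z ^+ (k.-1 - j) *: 'X^j : {poly C}.
rewrite (@cintegral01_horner Q z); last first.
  move=> y zy.
  have zy0 : z - y%:C%C != 0 by rewrite subr_eq0.
  apply: (canLR (mulfK zy0)); rewrite [in LHS]horner_coef [X in _ - X]horner_coef.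
  rewrite -sumrB /Q horner_sum mulr_suml; apply: eq_bigr => k _.
  rewrite hornerZ horner_sum -mulrBr -mulrA; congr (_ * _).
  rewrite subrXX mulrC; congr (_ * _); apply: eq_bigr => j _.
  by rewrite !hornerE.
have -> : \sum_(i < size Q) Q`_i / i.+1%:R =
          monomial_ext (fun i => i.+1%:R^-1 : C^o) Q by [].
rewrite /Q linear_sum/= [in RHS]/Tpoly [in RHS]/monomial_ext horner_sum.
apply: eq_bigr => k _; rewrite hornerZ linearZ/=; congr (_ * _).
(* Reversing the index lets the sum run over the power of z instead of that of y. *)
rewrite linear_sum horner_sum (reindex_inj rev_ord_inj)/=.
apply: eq_bigr => j _; rewrite linearZ/= -/(monomial_ext _ _) monomial_extXn.
have jk := ltn_ord j; rewrite !hornerE mulrC.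
have -> : (k.-1 - (k - j.+1))%N = j by lia.
by have -> : (k - j.+1).+1 = (k - j)%N by lia.
Qed.

Lemma iter_Top_horner m (P : {poly C}) :
  iter m (@Top R) (fun x => P.[x]) = (fun x => (iter m Tpoly P).[x]).
Proof. by elim: m => // m IH; rewrite iterS IH Top_horner. Qed.

End TopPolynomial.

(** * Counting and valuations *)

Section Counting.
Local Open Scope nat_scope.

Lemma sum_leq_count (T : Type) (a : pred T) (r : seq T) :
  \sum_(x <- r) a x = count a r.
Proof. by rewrite -sum1_count [RHS]big_mkcond; apply: eq_bigr => x; case: (a x). Qed.

Lemma sum_nat_leq_le B L : \sum_(1 <= k < B) (k <= L) <= L.
Proof.
elim: B => [|B IH]; first by rewrite big_geq.
case: B IH => [|B] IH; first by rewrite big_geq.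
rewrite big_nat_recr//=; case: (leqP B.+1 L) => BL; last by rewrite addn0.
rewrite (@leq_trans (B.+1))// addn1 ltnS.
apply: (@leq_trans (\sum_(1 <= k < B.+1) 1)).
  by apply: leq_sum => i _; exact: leq_b1.
by rewrite sum_nat_const_nat muln1 subn1.
Qed.

Lemma sum_dvdn_logn_le (l B N : nat) : prime l -> 0 < N ->
  \sum_(1 <= k < B) (l ^ k %| N) <= logn l N.
Proof.
move=> pl N0; under eq_bigr do rewrite pfactor_dvdn//.
exact: sum_nat_leq_le.
Qed.

(** Legendre's formula with a free upper bound, so that several factorials can share one range of
    exponents. *)
Lemma logn_fact_wide (l B N : nat) : prime l -> N < B ->
  logn l N`! = \sum_(1 <= k < B) N %/ l ^ k.
Proof.
move=> pl NB; rewrite logn_fact// [RHS](@big_cat_nat _ _ _ N.+1)//=.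
rewrite [X in _ + X]big_nat_cond [X in _ + X]big1 ?addn0// => k.
rewrite andbT => /andP[Nk _]; rewrite divn_small//.
by rewrite (leq_trans Nk)// ltnW// ltn_expl// prime_gt1.
Qed.

Lemma logn_prod_nat (I : Type) (r : seq I) (f : I -> nat) (l : nat) :
  (forall i, 0 < f i) ->
  logn l (\prod_(i <- r) f i) = \sum_(i <- r) logn l (f i).
Proof.
move=> f0; elim: r => [|i r IH]; first by rewrite !big_nil logn1.
by rewrite !big_cons lognM// ?prodn_gt0// IH.
Qed.

Lemma dvdn_lognP (a b : nat) : 0 < a -> 0 < b ->
  (forall l, prime l -> logn l a <= logn l b) -> a %| b.
Proof.
move=> a0 b0 ab; apply/dvdn_partP => // l la.
have pl : prime l by move: la; rewrite mem_primes => /andP[].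
by rewrite p_part pfactor_dvdn// ab.
Qed.

(** The exact count is (a + K) %/ d - a %/ d. *)
Lemma count_multiples_window (d a K : nat) : 0 < d ->
  K %/ d <= \sum_(i < K) (d %| (a + i).+1).
Proof.
move=> d0.
have e : \sum_(i < K) (d %| (a + i).+1) + a %/ d = (a + K) %/ d.
  elim: K => [|K IH]; first by rewrite big_ord0 addn0.
  by rewrite big_ord_recr/= addnS divnS// -IH addnCA addnA.
rewrite -(leq_add2r (a %/ d)) e -divnMDl// addnC leq_div2r//.
by rewrite leq_add2l leq_divM.
Qed.

Lemma count_mask_ge (T : Type) (a : pred T) (msk : bitseq) (s : seq T) :
  size msk = size s -> count a s <= count a (mask msk s) + count negb msk.
Proof.
elim: msk s => [|b msk IH] [|x s]//= [] /IH.
by case: b => /=; case: (a x) => /=; lia.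
Qed.

(** In a nonincreasing list the entries satisfying an upward closed predicate form a prefix. *)
Lemma count_sorted_take (a : pred nat) (s : seq nat) (m : nat) :
  (forall x y, y <= x -> a y -> a x) -> sorted geq s -> m <= size s ->
  minn m (count a s) <= \sum_(i < m) a (nth 0 s i).
Proof.
move=> a_mono; elim: s m => [|x s IH] [|m]//= xs ms; rewrite ?min0n//.
rewrite big_ord_recl/=; have {}IH := IH m (path_sorted xs) ms.
case: (boolP (a x)) => ax; first by rewrite !add1n minnSS ltnS.
rewrite (_ : count a s = 0) ?addn0 ?minn0//.
apply/eqP; rewrite -leqn0 leqNgt -has_count; apply/hasPn => y ys.
have /allP/(_ _ ys) xy : all (geq x) s.
  by apply: order_path_min xs => u v w /= uv vw; exact: leq_trans vw uv.
by apply: contra ax; exact: a_mono.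
Qed.

(* If fewer than [m < n] of the sums [P i + Q j] reach [d], then all [P i] and
   [Q j] are below [d], since otherwise a whole row or column would reach it. *)
Lemma sum_div_perm_le (n m d rem h : nat) (P Q : 'I_n -> nat) (s : 'S_n) :
  m < n -> 0 < d ->
  \sum_(j < n) (P j + Q (s j)) %/ d <= rem + m ->
  minn m (\sum_(i < n) \sum_(j < n) (d <= P i + Q j)) <= h ->
  \sum_(j < n) (P j + Q (s j)) %/ d <= rem + h.
Proof.
move=> mn d0 Em; set c := \sum_(i < n) _ => mch.
case: (leqP m c) => mc; first by rewrite (leq_trans Em)// leq_add2l; lia.
apply: leq_trans (leq_addl _ _); rewrite (leq_trans _ mch)//.
rewrite (minn_idPr (ltnW mc)).
have Pd i : P i < d.
  rewrite ltnNge; apply: contraTN mc => dP; rewrite -leqNgt (leq_trans (ltnW mn))//.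
  rewrite /c (bigD1 i)//= (leq_trans _ (leq_addr _ _))//.
  rewrite -[X in X <= _](card_ord n) -sum1_card leq_sum// => j _.
  by rewrite (leq_trans dP) ?leq_addr.
have Qd j : Q j < d.
  rewrite ltnNge; apply: contraTN mc => dQ; rewrite -leqNgt (leq_trans (ltnW mn))//.
  rewrite /c -[X in X <= _](card_ord n) -sum1_card leq_sum// => i _.
  by rewrite (bigD1 j)//= (leq_trans dQ) ?leq_addl.
rewrite /c leq_sum// => j _.
rewrite (bigD1 (s j))//= (leq_trans _ (leq_addr _ _))//.
case: (leqP d) => dK; last by rewrite divn_small.
(* Both summands are below [d], so the quotient is at most 1. *)
by rewrite -ltnS ltn_divLR//; have := Pd j; have := Qd (s j); lia.
Qed.

End Counting.

(** * The linear factors and the valuation of Delta *)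

Section Factors.
Context {n : nat}.
Implicit Types P Q : 'I_n -> nat.

(** The constants c of the linear factors s + c in the numerators of all binom(s + P_j, P_j + Q_j),
    pooled in one list. *)
Definition factors P Q : seq int :=
  flatten [seq [seq i.+1%:Z | i <- index_iota 0 (P j)] ++
               [seq - i%:Z | i <- index_iota 0 (Q j)] | j <- enum 'I_n].

Lemma big_factors (T : Type) (idx : T) (op : Monoid.com_law idx) (f : int -> T)
    P Q :
  \big[op/idx]_(x <- factors P Q) f x =
  \big[op/idx]_(j < n) op (\big[op/idx]_(i < P j) f i.+1%:Z)
                          (\big[op/idx]_(i < Q j) f (- i%:Z)).
Proof.
rewrite /factors big_flatten big_map big_enum/=; apply: eq_bigr => j _.
by rewrite big_cat !big_map !big_mkord.
Qed.

Lemma count_multiples_int (d s P Q : nat) : (0 < d)%N ->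
  ((P + Q) %/ d <= \sum_(i < P) ((d %| (s%:Z + i.+1%:Z)%R)%Z : nat) +
                   \sum_(i < Q) ((d %| (s%:Z - i%:Z)%R)%Z : nat))%N.
Proof.
move=> d0; have QdQ : (Q <= d * Q)%N by rewrite leq_pmull.
(* The values s - Q + 1, ..., s + P may be negative; adding the multiple d Q makes them a window of
   naturals with the same divisibilities. *)
have := @count_multiples_window d (s + (d * Q - Q)) (Q + P) d0.
rewrite [X in (X %/ _ <= _)%N]addnC => /leq_trans; apply.
rewrite big_split_ord/= [X in (X <= _)%N]addnC leq_eqVlt; apply/orP; left; apply/eqP.
have shift (a : nat) (b : int) : a%:Z = b + d%:Z * Q%:Z -> (d %| a)%N = (d %| b)%Z.
  by move=> ab; rewrite -[LHS]/(d %| a%:Z)%Z ab rpredDr// dvdz_mulr.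
congr addn.
  by apply: eq_bigr => i _; congr (nat_of_bool _); apply: shift; lia.
rewrite (reindex_inj rev_ord_inj)/=; apply: eq_bigr => i _.
by congr (nat_of_bool _); apply: shift; have := ltn_ord i; lia.
Qed.

(** The pooled list forgets which ascending block came with which descending one, so they can be
    paired along any [g] into runs of consecutive integers. *)
Lemma count_factors_ge (d s : nat) P Q (g : 'S_n) : (0 < d)%N ->
  (\sum_(j < n) (P j + Q (g j)) %/ d <=
   count (fun x => (d %| (s%:Z + x)%R)%Z) (factors P Q))%N.
Proof.
move=> d0; rewrite -sum_leq_count big_factors/= big_split/=.
rewrite [X in (_ <= _ + X)%N](reindex_inj (@perm_inj _ g))/= -big_split/=.
by apply: leq_sum => j _; exact: count_multiples_int.
Qed.

End Factors.

Section DeltaValuation.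
Context {R : realType} {n : nat}.
Context (p q : 'I_n -> nat).

Lemma leq_K1 i j : (p i + q j <= K p q 1)%N.
Proof.
have : (p i + q j)%N \in Kseq p q.
  by rewrite mem_sort; apply/allpairsP; exists (i, j); rewrite !mem_enum.
have : sorted geq (Kseq p q) by apply: sort_sorted => x y; exact: leq_total.
rewrite /K/=; case: (Kseq p q) => //= x s xs; rewrite inE => /predU1P[->//|].
have /allP all_le : all (geq x) s.
  by apply: order_path_min xs => u v w /= uv vw; exact: leq_trans vw uv.
exact: all_le.
Qed.

Lemma floor_divn (a b : nat) : (0 < b)%N ->
  Num.floor (a%:R / b%:R : R) = (a %/ b)%:Z.
Proof.
move=> b0; apply: floor_def; have b0R : 0 < b%:R :> R by rewrite ltr0n.
have -> : ((a %/ b)%:Z + 1)%:~R = (a %/ b).+1%:R :> R by rewrite -natr1 intrD.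
rewrite -pmulrn ler_pdivlMr// ltr_pdivrMr// -!natrM ler_nat ltr_nat.
by rewrite leq_divM -ltn_divLR//=.
Qed.

Lemma mu_attained (w : R) : exists g : 'S_n, mu p q w =
  \sum_(j < n) (Num.floor ((p j + q (g j))%:R * w) - Num.floor ((p j + q j)%:R * w)).
Proof.
rewrite /mu; elim/big_ind: _ => [|x y [g1 e1] [g2 e2]|g _].
- by exists 1%g; rewrite big1// => j _; rewrite perm1 subrr.
- by case: (leP x y) => _; [exists g2|exists g1].
- by exists g.
Qed.

(** Replacing t / l by its fractional part lowers each floor by p_j + q_(g j) times the integer
    part; these corrections have the same total for every permutation and cancel. *)
Lemma mu_frac (t l : nat) : (0 < l)%N ->
  exists g : 'S_n, (`|mu p q (Defs.frac (t%:R / l%:R : R))| +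
    \sum_(j < n) (p j * t + q j * t) %/ l =
    \sum_(j < n) (p j * t + q (g j) * t) %/ l)%N.
Proof.
move=> l0; have [g eg] := mu_attained (Defs.frac (t%:R / l%:R)).
exists g; apply/eqP; rewrite -eqz_nat PoszD gez0_abs ?mu_ge0// eg.
have fl (a : nat) : Num.floor (a%:R * Defs.frac (t%:R / l%:R : R)) =
    (a * t %/ l)%:Z - a%:Z * Num.floor (t%:R / l%:R : R).
  rewrite /Defs.frac mulrBr -[X in _ - X](intrM _ a%:Z) floorDrz ?rpredN ?intr_int//.
  by rewrite -intrN intrKfloor mulrA -natrM !floor_divn.
have sumZ (f : 'I_n -> nat) : (\sum_j f j)%N%:Z = \sum_j (f j)%:Z.
  exact: (big_morph Posz PoszD erefl).
have psum : \sum_j (p j + q (g j))%N%:Z = \sum_j (p j + q j)%N%:Z :> int.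
  rewrite -!sumZ !big_split/=; congr (Posz (_ + _)).
  by rewrite [RHS](reindex_inj (@perm_inj _ g)).
under eq_bigr do rewrite !fl.
rewrite !sumrB -!mulr_suml psum !sumZ; apply/eqP.
under [X in _ + X]eq_bigr do rewrite -mulnDl.
under [RHS]eq_bigr do rewrite -mulnDl.
ring.
Qed.

Lemma logn_fact_small (l N : nat) : prime l -> (N < l ^ 2)%N ->
  logn l N`! = (N %/ l)%N.
Proof.
move=> pl Nl; rewrite (@logn_fact_wide l N.+2)// big_ltn// expn1.
rewrite big_nat_cond big1 ?addn0// => k; rewrite andbT => /andP[k2 _].
by rewrite divn_small// (leq_trans Nl)// leq_exp2l// prime_gt1.
Qed.

Lemma Delta_gt0 (t : nat) : (0 < Delta R p q t)%N.
Proof.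
rewrite /Delta; case: finite_supportP => [|X XP _ _]; first by rewrite big_nil.
rewrite big_seq; apply: prodn_cond_gt0 => s sX.
by have [/prime_gt0 s0 _] := XP _ sX; rewrite expn_gt0 s0.
Qed.

(** The finite-support product is either the default empty product or a product over distinct
    primes, so [l] contributes at most its own exponent. *)
Lemma logn_Delta (t l : nat) : prime l ->
  (logn l (Delta R p q t) <=
   if `[< Delta_primes R p q t l >]
   then `|mu p q (Defs.frac (t%:R / l%:R : R))| else 0)%N.
Proof.
move=> pl; rewrite /Delta; case: finite_supportP => [|X XP _ _].
  by rewrite big_nil logn1.
have := finmap.fset_uniq X; have := XP : forall s, s \in finmap.enum_fset X -> _.
move: (finmap.enum_fset X) => r {X XP} rP r_uniq.
set e := fun s : nat => `|mu p q (Defs.frac (t%:R / s%:R : R))|%N.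
have r_prime s : s \in r -> prime s by move=> /rP[].
have -> : (logn l (\prod_(s <- r) s ^ e s) = \sum_(s <- r) (s == l) * e l)%N.
  elim: r r_prime {rP r_uniq} => [|s r IH] r_prime; first by rewrite !big_nil logn1.
  have ps : prime s by rewrite r_prime ?mem_head.
  have r_prime' i : i \in r -> prime i by move=> ir; rewrite r_prime// inE ir orbT.
  rewrite !big_cons lognM; first last.
  - rewrite big_seq prodn_cond_gt0// => i /r_prime' pi.
    by rewrite expn_gt0 prime_gt0.
  - by rewrite expn_gt0 prime_gt0.
  rewrite IH// lognX logn_prime// eq_sym mulnC.
  by case: eqP => [->|].
rewrite -big_distrl/= sum_leq_count count_uniq_mem//.
case: (boolP (l \in r)) => [lr|]; last by rewrite mul0n.
by rewrite mul1n ifT//; apply/asboolP; exact: rP.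
Qed.

(* [Delta] is the gain obtained by regrouping the factors along the permutation
   that maximizes [mu]; a prime [l] occurs in it only if [(p i + q j) t < l^2],
   where Legendre's formula has a single term. *)
Lemma logn_Delta_fact (t l : nat) : prime l -> exists g : 'S_n,
  (logn l (Delta R p q t) + \sum_(j < n) logn l ((p j * t + q j * t)`!) <=
   \sum_(j < n) logn l ((p j * t + q (g j) * t)`!))%N.
Proof.
move=> pl; have := logn_Delta t l pl; case: asboolP => [[_ sl]|_]; last first.
  rewrite leqn0 => /eqP->; exists 1%g; rewrite add0n.
  by apply/eq_leq/eq_bigr => j _; rewrite perm1.
have [g eg] := mu_frac t l (prime_gt0 pl).
have small i j : (p i * t + q j * t < l ^ 2)%N.
  rewrite -mulnDl (leq_ltn_trans (leq_mul (leq_K1 i j) (leqnn t)))//.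
  rewrite -(ltr_nat R) natrM natrX.
  rewrite -[X in X < _]sqr_sqrtr ?mulr_ge0//.
  by rewrite ltr_pXn2r// nnegrE ?sqrtr_ge0.
move=> muD; exists g; under [leqRHS]eq_bigr do rewrite logn_fact_small//.
by rewrite -eg leq_add// leq_sum// => j _; rewrite logn_fact_small.
Qed.

End DeltaValuation.

(** * Divisibility *)

Section Divisibility.
Context {R : realType} {n : nat}.
Context (p q : 'I_n -> nat) (t : nat).

Lemma dvdn_dlcm (k : nat) (x : R) : (0 < k <= Num.truncn x)%N -> (k %| dlcm x)%N.
Proof.
rewrite -(ltnS k) -mem_index_iota /dlcm; elim: index_iota => // i r IH.
rewrite inE big_cons => /predU1P[->|/IH kr]; first exact: dvdn_lcml.
exact: dvdn_trans (dvdn_lcmr _ _).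
Qed.

Lemma dlcm_gt0 (x : R) : (0 < dlcm x)%N.
Proof.
rewrite /dlcm big_nat; elim/big_ind: _ => // [a b|k /andP[]//].
by rewrite lcmn_gt0 => -> ->.
Qed.

Lemma leq_truncn_N (l : nat) : (K p q l * t <= Num.truncn (N R p q l * t%:R))%N.
Proof.
have KN : (K p q l)%:R <= N R p q l.
  by rewrite /N; case: eqP => [->//|_]; rewrite le_max lexx.
rewrite truncn_ge_nat ?natrM ?ler_wpM2r//.
by rewrite mulr_ge0// (le_trans _ KN).
Qed.

(** The sums reaching [d] come first in the decreasing list, and K_l t is at most the integer part
    of N_l t. *)
Lemma count_N_ge (m d : nat) : (m < n)%N ->
  (minn m (\sum_(i < n) \sum_(j < n) (d <= p i * t + q j * t)) <=
   \sum_(1 <= l < m.+1) (d <= Num.truncn (N R p q l * t%:R)))%N.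
Proof.
move=> mn; rewrite big_add1/= big_mkord.
pose a x := (d <= x * t)%N.
have -> : (\sum_(i < n) \sum_(j < n) (d <= p i * t + q j * t) =
           count a (Kseq p q))%N.
  rewrite /Kseq count_sort -sum_leq_count big_allpairs_dep/= big_enum/=.
  apply: eq_bigr => i _; rewrite big_enum/=; apply: eq_bigr => j _.
  by rewrite /a mulnDl.
apply: (@leq_trans (\sum_(i < m) a (nth 0%N (Kseq p q) i))).
  apply: count_sorted_take.
  - by move=> x y yx; rewrite /a => /leq_trans; apply; rewrite leq_mul2r yx orbT.
  - by apply: sort_sorted => x y; exact: leq_total.
  - rewrite size_sort size_allpairs -cardE card_ord.
    by rewrite (leq_trans (ltnW mn))// leq_pmull// (leq_trans _ mn).
apply: leq_sum => i _; rewrite /a; case: (leqP d) => // di.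
by rewrite (leq_trans di (leq_truncn_N i.+1)).
Qed.

Lemma sum_leq_logn_dlcm (l B : nat) (x : R) : prime l ->
  (\sum_(1 <= k < B) (l ^ k <= Num.truncn x) <= logn l (dlcm x))%N.
Proof.
move=> pl; apply: leq_trans (sum_dvdn_logn_le l B _ pl (dlcm_gt0 x)).
apply: leq_sum => k _; case: (leqP (l ^ k)) => // lk.
by rewrite dvdn_dlcm// expn_gt0 prime_gt0.
Qed.

Lemma sum_count_logn_prod (l B : nat) (f : int -> int) (r : seq int) :
  prime l -> \prod_(x <- r) f x != 0 ->
  (\sum_(1 <= k < B) count (fun x => ((l ^ k)%N %| f x)%Z) r <=
   logn l `|(\prod_(x <- r) f x)%R|)%N.
Proof.
move=> pl; elim: r => [|x r IH]; first by move=> _; rewrite big1.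
rewrite big_cons mulf_eq0 negb_or => /andP[fx r0] /=; rewrite big_split/=.
rewrite abszM lognM ?absz_gt0// leq_add ?IH//.
by apply: sum_dvdn_logn_le; rewrite ?absz_gt0.
Qed.

(** The valuations are compared prime by prime, and the permutation [g] may depend on the prime [l].
    For each power l^k, the quotients of the regrouped block lengths are bounded by the multiples of
    l^k among the surviving factors plus the number of lcm's that l^k divides. *)
Lemma Delta_dvdn (m s : nat) (msk : bitseq) :
  let P j := (p j * t)%N in let Q j := (q j * t)%N in
  (m < n)%N -> size msk = size (factors P Q) -> count negb msk = m ->
  (Delta R p q t * \prod_(j < n) (P j + Q j)`! %|
   \prod_(1 <= l < m.+1) dlcm (N R p q l * t%:R) *
   `|(\prod_(x <- mask msk (factors P Q)) (s%:Z + x))%R|)%N.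
Proof.
move=> P Q mn sm cm; set v := (\prod_(x <- _) _)%R.
have [->|v0] := eqVneq v 0; first by rewrite muln0 dvdn0.
have D0 : (0 < \prod_(1 <= l < m.+1) dlcm (N R p q l * t%:R))%N.
  by rewrite prodn_gt0// => l; exact: dlcm_gt0.
have F0 : (0 < \prod_(j < n) (P j + Q j)`!)%N.
  by rewrite prodn_gt0// => j; exact: fact_gt0.
apply: dvdn_lognP => [||l pl].
- by rewrite muln_gt0 Delta_gt0.
- by rewrite muln_gt0 D0 absz_gt0.
rewrite !lognM ?Delta_gt0 ?absz_gt0//.
have -> : (logn l (\prod_(j < n) (P j + Q j)`!) = \sum_(j < n) logn l (P j + Q j)`!)%N.
  by apply: logn_prod_nat => j; exact: fact_gt0.
have -> : (logn l (\prod_(1 <= i < m.+1) dlcm (N R p q i * t%:R)) =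
           \sum_(1 <= i < m.+1) logn l (dlcm (N R p q i * t%:R)))%N.
  by apply: logn_prod_nat => j; exact: dlcm_gt0.
have [g /leq_trans] := @logn_Delta_fact R n p q t l pl; apply.
(* A bound above every block length, common to all the Legendre sums. *)
pose B := (\sum_(j < n) (P j + Q (g j))).+1.
have -> : (\sum_(j < n) logn l (P j + Q (g j))`! =
           \sum_(1 <= k < B) \sum_(j < n) (P j + Q (g j)) %/ l ^ k)%N.
  rewrite exchange_big/=; apply: eq_bigr => j _; apply: logn_fact_wide => //.
  by rewrite /B ltnS (bigD1 j)//= leq_addr.
apply: leq_trans (leq_add (leqnn _) (sum_count_logn_prod l B _ _ pl v0)).
apply: (@leq_trans (\sum_(1 <= k < B)
    (\sum_(1 <= i < m.+1) (l ^ k <= Num.truncn (N R p q i * t%:R)) +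
     count (fun x => ((l ^ k)%N %| (s%:Z + x)%R)%Z) (mask msk (factors P Q))))).
  apply: leq_sum => k _; rewrite [leqRHS]addnC.
  have lk0 : (0 < l ^ k)%N by rewrite expn_gt0 prime_gt0.
  apply: (@sum_div_perm_le n m (l ^ k) _ _ P Q g mn lk0); last exact: count_N_ge.
  (* Deleting [m] factors loses at most [m] multiples of l^k. *)
  apply: leq_trans (count_factors_ge (l ^ k) s P Q g lk0) _.
  by rewrite -[in leqRHS]cm count_mask_ge.
rewrite big_split/= leq_add2r exchange_big/=.
by apply: leq_sum => i _; exact: sum_leq_logn_dlcm.
Qed.

End Divisibility.

(** * Integrality of the scaled derivatives and conclusion *)

Section LegendreInteger.
Context {R : realType} {n : nat}.
Context (p q : 'I_n -> nat) (t : nat).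
Let P j := (p j * t)%N.
Let Q j := (q j * t)%N.
Let G : {poly int} := \prod_(x <- factors P Q) ('X + x%:P).

Lemma prod_ubinom (F : fieldType) :
  \prod_(j < n) ubinom (P j) (Q j) =
  ((\prod_(j < n) (P j + Q j)`!)%N%:R)^-1 *: map_poly intr G :> {poly F}.
Proof.
rewrite /G big_factors/= /ubinom scaler_prod prodfV -natr_prod.
congr (_ *: _); rewrite rmorph_prod; apply: eq_bigr => j _.
rewrite rmorphM !rmorph_prod; congr (_ * _); apply: eq_bigr => i _.
  by rewrite rmorphD/= map_polyX map_polyC.
by rewrite rmorphD/= map_polyX map_polyC/= intrN.
Qed.

(** Divisibility of the scaled value at [s] is additive in the polynomial, so [derivn_prod_ind]
    reduces it to products with [m] factors deleted. *)
Lemma Delta_dvdz_derivn (m s : nat) : (m < n)%N ->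
  ((Delta R p q t * \prod_(j < n) (P j + Q j)`!)%N%:Z %|
   (\prod_(1 <= l < m.+1) dlcm (N R p q l * t%:R))%N%:Z * (G^`(m)).[s%:Z])%Z.
Proof.
move=> mn; set D := (\prod_(1 <= l < _) _)%N; set d := (_ * _)%N.
apply: (@derivn_prod_ind _ (fun u => (d%:Z %| D%:Z * u.[s%:Z])%Z)).
- by rewrite horner0 mulr0 dvdz0.
- by move=> u v du dv; rewrite hornerD mulrDr rpredD.
- move=> msk sm cm; rewrite horner_prod.
  under eq_bigr do rewrite !hornerE.
  by rewrite dvdzE abszM; exact: Delta_dvdn.
Qed.

End LegendreInteger.

Lemma intr_quotient {F : fieldType} (d e D m : nat) (a b : int) :
  d%:R != 0 :> F -> e%:R != 0 :> F -> D%:Z * b = a * (d * e)%N%:Z ->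
  d%:R^-1 * D%:R * (-1) ^+ m * e%:R^-1 * b%:~R = ((-1) ^+ m * a)%:~R :> F.
Proof.
move=> d0 e0 /(congr1 (fun i : int => i%:~R : F)).
rewrite !intrM -!pmulrn natrM => Dbade.
transitivity (d%:R^-1 * e%:R^-1 * (-1) ^+ m * (D%:R * b%:~R) : F); first by ring.
by rewrite Dbade rmorphXn rmorphN1/=; field; rewrite d0 e0.
Qed.

Theorem theorem6p1 (R : realType) (n m : nat) (hn : (2 <= n)%N)
  (hm : (1 <= m <= n - 1)%N) (p q : 'I_n -> nat) (t : nat) :
  exists Q : {poly int}, forall z : R[i],
    ((Delta R p q t)%:R)^-1
    * (\prod_(1 <= j < m.+1) dlcm (N R p q j * t%:R))%:R
    * iter m (@Top R)
        (fun x => (legendre R[i] [seq ((p i * t)%N, (q i * t)%N) | i <- enum 'I_n]).[x]) z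
    = (map_poly intr Q).[z].
Proof.
have mn : (m < n)%N by move: hm; lia.
rewrite legendre_umbral big_map big_enum/= prod_ubinom iter_Top_horner.
rewrite iter_Tpoly_umbral; last exact: pchar_num.
set G := \prod_(x <- _) _; set D := (\prod_(1 <= l < _) _)%N.
set E := (\prod_(j < n) _)%N; set De := Delta R p q t.
have De0 : De%:R != 0 :> R[i] by rewrite pnatr_eq0 -lt0n Delta_gt0.
have E0 : E%:R != 0 :> R[i].
  by rewrite pnatr_eq0 -lt0n prodn_gt0// => j; exact: fact_gt0.
(* The sign comes from T acting as -d/ds, and [E] from the denominators of the binomials. *)
pose c : R[i] := De%:R^-1 * D%:R * (-1) ^+ m * E%:R^-1.
have [s|Q hQ] := @umbral_int R[i] (c *: map_poly intr G^`(m)).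
  have /dvdzP[a ha] := @Delta_dvdz_derivn R n p q t m s mn.
  exists ((-1) ^+ m * a); rewrite hornerZ pmulrn (horner_map intr).
  exact: intr_quotient.
exists Q => z; rewrite -hQ derivnZ derivn_map !linearZ/= !hornerZ /c.
by ring.
Qed.
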